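(* Let $R,S$ be finite undirected graphs and $\mathfrak{U}'\subseteq\mathfrak{U}$. Assume that either $\mathfrak{U}'=\mathfrak{U}$ (with $R\in\mathfrak{U}$), or $R\in\mathfrak{C}_o\subseteq\mathfrak{U}'\subseteq\mathfrak{U}$. Let $\mathcal{E}(R),\mathcal{E}(S)$ be the EV-systems of $R$ and $S$ with respect to $\mathfrak{U}'$. Let $\rho$ be a strong S-scheme from $R$ to $S$ with respect to $\mathfrak{U}'$ such that, for all $G,H\in\mathfrak{U}'$, $\xi\in\mathcal{S}_u(G,R)$, $\zeta\in\mathcal{S}_u(H,R)$, $v\in V(G)$, $w\in V(H)$, $$\alpha^R_{G,\xi}(v)=\alpha^R_{H,\zeta}(w)\ \Longrightarrow\ \alpha^S_{G,\rho_G(\xi)}(v)=\alpha^S_{H,\rho_H(\zeta)}(w).$$ Put $\epsilon:=\alpha^S_{\mathcal{E}(R),\,\rho_{\mathcal{E}(R)}(\phi_R)}$. Then: - $\epsilon$ is one-to-one; - $\epsilon$ induces $\rho$, i.e. $\rho_G(\xi)=\phi_S\circ\epsilon\circ\alpha^R_{G,\xi}$ for all $G\in\mathfrak{U}'$ and $\xi\in\mathcal{S}_u(G,R)$; - $\epsilon$ fulfills Condition 1, i.e. $\alpha^S_{G,\rho_G(\xi)}=\epsilon\circ\alpha^R_{G,\xi}$ for all $G\in\mathfrak{U}'$ and $\xi\in\mathcal{S}_u(G,R)$.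
   Context: An undirected graph $G$ has a finite nonempty vertex set $V(G)$ and an edge set $A(G)$ consisting of subsets of $V(G)$ of size 1 (loops) or 2 (proper edges). $G^*$ is $G$ with loops removed. $N_G(v)$ is the set of $w\neq v$ with $\{v,w\}\in A(G)$. A homomorphism $\xi:G\to H$ is a map $V(G)\to V(H)$ sending every edge $\{v,w\}$ to an edge $\{\xi(v),\xi(w)\}$. It is strict if, in addition, it sends proper edges to proper edges. $\mathcal{S}_u(G,H)$ is the set of strict homomorphisms. Classes of graphs: - $\mathfrak{U}$ is a representative system of the isomorphism classes of finite undirected graphs; constructed graphs are identified with their representatives. - $\mathfrak{C}_o=\{G\in\mathfrak{U}: G^*\text{ contains no cycle of odd length}\}$. An S-scheme from $R$ to $S$ with respect to $\mathfrak{U}'$ is a family of maps $\rho_G:\mathcal{S}_u(G,R)\to\mathcal{S}_u(G,S)$, $G\in\mathfrak{U}'$. It is strong if each $\rho_G$ is injective. EV-system of an undirected graph $T$ with respect to $\mathfrak{U}'$: - Vertex set $\mathcal{E}_o(T)=\{(v,D):v\in V(T),\ D\subseteq N_T(v)\}$, with components $\mathfrak{a}_1,\mathfrak{a}_2$. - $\phi_T(\mathfrak{a})=\mathfrak{a}_1$. - For $G\in\mathfrak{U}'$ and $\xi\in\mathcal{S}_u(G,T)$, $\alpha^T_{G,\xi}(v)=(\xi(v),\xi[N_G(v)])$. - $\{\mathfrak{a},\mathfrak{b}\}$ (where $\mathfrak{a}=\mathfrak{b}$ is allowed) is an edge of $\mathcal{E}(T)$ iff there exist $G\in\mathfrak{U}'$,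 $\xi\in\mathcal{S}_u(G,T)$ and $\{v,w\}\in A(G)$ (where $v=w$ is allowed) with $\mathfrak{a}=\alpha^T_{G,\xi}(v)$ and $\mathfrak{b}=\alpha^T_{G,\xi}(w)$. In both settings $\mathcal{E}(R)\in\mathfrak{U}'$ and $\phi_R\in\mathcal{S}_u(\mathcal{E}(R),R)$, so $\epsilon$ is defined. *)

(* Defs.v *)
(* [boolp] provides the classical truth value [`[< P >]] and choice. *)
From HB Require Import structures.
From mathcomp Require Import all_boot.
From mathcomp Require Import boolp.

Set Implicit Arguments.
Unset Strict Implicit.
Unset Printing Implicit Defensive.

Record ugraph := UGraph {
  vertex :> finType;
  edges : {set {set vertex}};
  vertex_gt0 : 0 < #|vertex|;
  edges_card : forall e, e \in edges -> 0 < #|e| <= 2 }.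

(* [v; v] denotes the loop at [v]. *)
Notation "[ 'edge' v ; w 'of' G ]" := ([set v; w] \in edges G)
  (at level 0, v at level 99, w at level 99, G at level 99,
   format "[ 'edge'  v ;  w  'of'  G ]").

(* Adjacency in the loop-free graph G^*. *)
Definition padj (G : ugraph) : rel G := fun v w => (v != w) && [edge v; w of G].

Definition nbr (G : ugraph) (v : G) : {set G} :=
  [set w | (w != v) && [edge v; w of G]].

(* [ucycle] is a cyclic sequence of pairwise distinct vertices.  As [padj] is
   irreflexive, an odd one has length at least 3. *)
Definition no_odd_cycle (G : ugraph) : Prop :=
  forall c : seq G, ucycle (@padj G) c -> ~~ odd (size c).

Definition is_hom (G H : ugraph) (f : {ffun G -> H}) : bool :=
  [forall v, forall w, [edge v; w of G] ==> [edge f v; f w of H]].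

Definition is_strict_hom (G H : ugraph) (f : {ffun G -> H}) : bool :=
  is_hom f &&
  [forall v, forall w, (v != w) && [edge v; w of G] ==> (f v != f w)].

Definition shom (G H : ugraph) := {f : {ffun G -> H} | is_strict_hom f}.

Definition shom_fun (G H : ugraph) (f : shom G H) : G -> H := val f.
Coercion shom_fun : shom >-> Funclass.

Lemma is_strict_homP (G H : ugraph) (f : {ffun G -> H}) :
  reflect (forall v w, [edge v; w of G] ->
             [edge f v; f w of H] /\ (v != w -> f v != f w))
          (is_strict_hom f).
Proof.
apply: (iffP andP) => [[/forallP h1 /forallP h2] v w e | h].
  have /forallP/(_ w)/implyP h1' := h1 v.
  have /forallP/(_ w)/implyP h2' := h2 v.
  by split; [exact: h1' | move=> vw; apply: h2'; rewrite vw].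
split; apply/forallP => v; apply/forallP => w; apply/implyP.
  by move=> /h[].
by case/andP=> vw /h[_]; apply.
Qed.

Lemma shom_edge (G H : ugraph) (f : shom G H) v w :
  [edge v; w of G] -> [edge f v; f w of H].
Proof. by move=> /((is_strict_homP _ (valP f)) v w)[]. Qed.

Lemma shom_proper (G H : ugraph) (f : shom G H) v w :
  [edge v; w of G] -> v != w -> f v != f w.
Proof. by move=> /((is_strict_homP _ (valP f)) v w)[]. Qed.

Definition mk_shom (G H : ugraph) (f : G -> H)
    (hf : forall v w, [edge v; w of G] ->
            [edge f v; f w of H] /\ (v != w -> f v != f w)) : shom G H.
Proof.
exists (finfun f); apply/is_strict_homP => v w /hf; by rewrite !ffunE.
Defined.

Lemma mk_shomE (G H : ugraph) (f : G -> H) hf : @mk_shom G H f hf =1 f.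
Proof. by move=> v; rewrite /shom_fun /= ffunE. Qed.

Record giso (G H : ugraph) := GIso {
  iso_fun :> G -> H;
  iso_inv : H -> G;
  iso_funK : cancel iso_fun iso_inv;
  iso_invK : cancel iso_inv iso_fun;
  iso_edge : forall v w, [edge iso_fun v; iso_fun w of H] = [edge v; w of G] }.

(* A representative system of the isomorphism classes.  [rep_iso] is the
   identification of a graph with its representative. *)
Record repsys := RepSys {
  rep : ugraph -> ugraph;
  rep_iso : forall G, giso G (rep G);
  rep_eq : forall G H, giso G H -> rep G = rep H }.

Definition giso_refl (G : ugraph) : giso G G :=
  @GIso G G id id (fun _ => erefl) (fun _ => erefl) (fun _ _ => erefl).

Definition giso_sym (G H : ugraph) (i : giso G H) : giso H G.
Proof.
apply: (@GIso H G (iso_inv i) i (iso_invK i) (iso_funK i)) => v w.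
by rewrite -(iso_edge i) !iso_invK.
Defined.

Definition giso_trans (G H K : ugraph) (i : giso G H) (j : giso H K) : giso G K.
Proof.
apply: (@GIso G K (j \o i) (iso_inv i \o iso_inv j)) => [v|v|v w] /=.
- by rewrite !iso_funK.
- by rewrite !iso_invK.
- by rewrite !iso_edge.
Defined.

Lemma repsys_exists : inhabited repsys.
Proof.
have ex (G : ugraph) : exists H, inhabited (giso G H).
  by exists G; constructor; exact: giso_refl.
pose r G := projT1 (cid (ex G)).
have ri G : giso G (r G).
  have : exists _ : giso G (r G), True.
    by case: (projT2 (cid (ex G))) => i; exists i.
  by move=> /cid[].
constructor; apply: (@RepSys r ri) => G H i; rewrite /r.
suff E : (fun K => inhabited (giso G K)) = (fun K => inhabited (giso H K)).
  by move: (ex G) (ex H); rewrite E => p q; rewrite (Prop_irrelevance p q).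
apply/funext => K; apply/propext; split=> -[j]; constructor.
- exact: giso_trans (giso_sym i) j.
- exact: giso_trans i j.
Qed.

Definition in_U (rs : repsys) (G : ugraph) : Prop := rep rs G = G.

Definition in_Co (rs : repsys) (G : ugraph) : Prop := in_U rs G /\ no_odd_cycle G.

Definition setting (rs : repsys) (U' : ugraph -> Prop) (R : ugraph) : Prop :=
  (in_U rs R /\ (forall G, U' G <-> in_U rs G)) \/
  [/\ in_Co rs R, forall G, in_Co rs G -> U' G & forall G, U' G -> in_U rs G].

Definition member (U' : ugraph -> Prop) := {G : ugraph | U' G}.

Definition member_graph (U' : ugraph -> Prop) (G : member U') : ugraph := sval G.
Coercion member_graph : member >-> ugraph.

Definition scheme (U' : ugraph -> Prop) (R S : ugraph) :=
  forall G : member U', shom G R -> shom G S.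

Definition strong (U' : ugraph -> Prop) (R S : ugraph) (rho : scheme U' R S) :=
  forall G : member U', injective (rho G).

Definition evertex (T : ugraph) := {a : T * {set T} | a.2 \subset nbr a.1}.

Lemma alpha_subproof (G T : ugraph) (xi : shom G T) (v : G) :
  xi @: nbr v \subset nbr (xi v).
Proof.
apply/subsetP => y /imsetP[w]; rewrite inE => /andP[wv e] ->.
by rewrite inE shom_edge // andbT eq_sym shom_proper // eq_sym.
Qed.

Definition alpha (G T : ugraph) (xi : shom G T) (v : G) : evertex T :=
  exist _ (xi v, xi @: nbr v) (alpha_subproof xi v).

Definition ev_adj (U' : ugraph -> Prop) (T : ugraph) (a b : evertex T) : Prop :=
  exists (G : member U') (xi : shom G T) (v w : G),
    [/\ [edge v; w of G], a = alpha xi v & b = alpha xi w].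

Definition ev_edges (U' : ugraph -> Prop) (T : ugraph) : {set {set evertex T}} :=
  [set e | `[< exists a b : evertex T, e = [set a; b] /\ ev_adj U' a b >]].

Lemma ev_card_gt0 (T : ugraph) : 0 < #|{: evertex T}|.
Proof.
have /card_gt0P[x _] := vertex_gt0 T.
by apply/card_gt0P; exists (Sub (x, set0) (sub0set (nbr x))).
Qed.

Lemma ev_edges_card (U' : ugraph -> Prop) (T : ugraph) :
  forall e, e \in ev_edges U' T -> 0 < #|e| <= 2.
Proof.
move=> e; rewrite inE => /asboolP[a [b [-> _]]].
by rewrite cards2; case: (a != b).
Qed.

Definition EV (U' : ugraph -> Prop) (T : ugraph) : ugraph :=
  UGraph (ev_card_gt0 T) (@ev_edges_card U' T).

Lemma ev_edgeP (U' : ugraph -> Prop) (T : ugraph) (a b : EV U' T) :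
  reflect (ev_adj U' a b) [edge a; b of EV U' T].
Proof.
have sym (c d : evertex T) : ev_adj U' c d -> ev_adj U' d c.
  by move=> [G [xi [v [w [e -> ->]]]]]; exists G, xi, w, v; rewrite setUC.
rewrite inE; apply: (iffP idP) => [/asboolP[c [d [eq h]]] | h]; last first.
  by apply/asboolP; exists a, b.
have : c \in [set a; b] by rewrite eq set21.
have : d \in [set a; b] by rewrite eq set22.
have : a \in [set c; d] by rewrite -eq set21.
have : b \in [set c; d] by rewrite -eq set22.
move=> /set2P[] bE /set2P[] aE /set2P[] dE /set2P[] cE; move: h (sym _ _ h);
  congruence.
Qed.

Lemma phi_subproof (U' : ugraph -> Prop) (T : ugraph) (a b : EV U' T) :
  [edge a; b of EV U' T] ->
  [edge (val a).1; (val b).1 of T] /\ (a != b -> (val a).1 != (val b).1).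
Proof.
move=> /ev_edgeP[G [xi [v [w [e -> ->]]]]] /=; split; first exact: shom_edge.
by move=> ab; apply: shom_proper e _; apply: contra_neq ab => ->.
Qed.

Definition phi (U' : ugraph -> Prop) (T : ugraph) : shom (EV U' T) T :=
  mk_shom (@phi_subproof U' T).

Lemma iso_inv_subproof (G H T : ugraph) (i : giso G H) (f : shom G T) (v w : H) :
  [edge v; w of H] ->
  [edge f (iso_inv i v); f (iso_inv i w) of T] /\
  (v != w -> f (iso_inv i v) != f (iso_inv i w)).
Proof.
rewrite -{1}(iso_invK i v) -{1}(iso_invK i w) iso_edge => e.
split; first exact: shom_edge.
move=> vw; apply: shom_proper e _; apply: contra_neq vw.
exact: (can_inj (iso_invK i)).
Qed.

Definition iso_transport (G H T : ugraph) (i : giso G H) (f : shom G T) :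
  shom H T := mk_shom (iso_inv_subproof i f).

Lemma not_uniq_split (T : eqType) (s : seq T) :
  ~~ uniq s -> exists x p1 p2 p3, s = p1 ++ x :: p2 ++ x :: p3.
Proof.
elim: s => //= y s IHs; rewrite negb_and negbK => /orP[/splitPr[p q]|].
  by exists y, [::], p, q.
by move=> /IHs[x [p1 [p2 [p3 ->]]]]; exists x, (y :: p1), p2, p3.
Qed.

Lemma odd_cycle_ucycle (T : eqType) (e : rel T) (c : seq T) :
  cycle e c -> odd (size c) -> exists2 c', ucycle e c' & odd (size c').
Proof.
have [n] := ubnP (size c); elim: n c => // n IHn c /ltnSE sc ec oc.
have [uc|/not_uniq_split[x [p1 [p2 [p3 cE]]]]] := boolP (uniq c).
  by exists c => //; rewrite /ucycle ec.
have scE : size c = (size p2).+1 + (size (p3 ++ p1)).+1.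
  by rewrite cE size_cat /= !size_cat /= [LHS]addnC !addnS !addSn addnA.
move: ec; rewrite cE -(rot_cycle (size p1)) rot_size_cat /= -!catA rcons_cat /=.
rewrite cat_path /= => /and3P[h2 h2' h3].
have c2 : cycle e (x :: p2) by rewrite /= rcons_path h2.
have c3 : cycle e (x :: p3 ++ p1) by [].
have [o2|e2] := boolP (odd (size (x :: p2))).
  by apply: IHn c2 o2; apply: leq_trans sc; rewrite scE /= addnS ltnS leq_addr.
apply: (IHn _ _ c3); first by apply: leq_trans sc; rewrite scE /= addSn ltnS leq_addl.
by move: oc e2; rewrite scE oddD /=; case: (odd (size p2)).
Qed.

Lemma shom_no_odd_cycle (G H : ugraph) (f : shom G H) :
  no_odd_cycle H -> no_odd_cycle G.
Proof.
move=> hH c /andP[cc _]; apply/negP => oc.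
have hf : {homo f : v w / padj v w}.
  by move=> v w /andP[vw e]; rewrite /padj (shom_proper _ e) ?shom_edge.
have fc : cycle (@padj H) (map f c) by apply: homo_cycle cc.
have [|c' uc'] := odd_cycle_ucycle fc; first by rewrite size_map.
by apply/negP/hH.
Qed.

Lemma EV_in_class (rs : repsys) (U' : ugraph -> Prop) (R : ugraph) :
  setting rs U' R -> U' (rep rs (EV U' R)).
Proof.
have inU : in_U rs (rep rs (EV U' R)).
  by rewrite /in_U -(rep_eq rs (rep_iso rs (EV U' R))).
case=> [[_ h]|[[_ hR] h _]]; first exact/h.
apply: h; split=> //.
exact: shom_no_odd_cycle (iso_transport (rep_iso rs (EV U' R)) (phi U' R)) hR.
Qed.

Definition EV_member (rs : repsys) (U' : ugraph -> Prop) (R : ugraph)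
    (hU : setting rs U' R) : member U' :=
  exist _ (rep rs (EV U' R)) (EV_in_class hU).

(* The scheme is only available on the representative of E(R), so phi_R and the
   vertices of E(R) are transported along [rep_iso]. *)
Definition epsilon (rs : repsys) (U' : ugraph -> Prop) (R S : ugraph)
    (hU : setting rs U' R) (rho : scheme U' R S) : EV U' R -> EV U' S :=
  fun a => let i := rep_iso rs (EV U' R) in
    alpha (rho (EV_member hU) (iso_transport i (phi U' R))) (i a).

(* Main.v *)
(* Every vertex a = (v, D) of E(R) is alpha xi c for the center c of a star
   mapped to R with leaves onto D.  Stars are bipartite, so they are available
   in both settings, and alpha phi_R is the identity of E(R); the assumption on
   rho, applied to xi and phi_R, then gives Condition 1, and its first
   components say that epsilon induces rho.
   For injectivity let epsilon (v, D) = epsilon (w, E).  By Condition 1 the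
   second component of epsilon (v, D) is the set of values of rho on the leaves
   of the star at v.  Hence the leaves d of the star at v and e of the star at w
   with equal values of rho form a correspondence, total on both sides.  The
   star with one leaf for each such pair (d, e) has two homomorphisms to R,
   centered at v and at w, with the same image under rho; they coincide because
   rho is strong. *)
Require Import Defs.
From mathcomp Require Import all_boot.

Set Implicit Arguments.
Unset Strict Implicit.
Unset Printing Implicit Defensive.

(** * Absence of odd cycles *)

(** Each step of a path flips the color, so a path that returns to its start has even length. *)
Lemma bicoloring_no_odd_cycle (G : ugraph) (c : G -> bool) :
  (forall v w, padj v w -> c w = ~~ c v) -> no_odd_cycle G.
Proof.
move=> hc s /andP[cs _].
have color_last x p : path (@padj G) x p -> c (last x p) = c x (+) odd (size p).
  elim: p x => [|y p IHp] x /=; first by rewrite addbF.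
  by case/andP=> /hc cy /IHp ->; rewrite cy addbN addNb.
case: s cs => //= x s /color_last; rewrite last_rcons size_rcons /=.
by case: (c x); case: (odd (size s)).
Qed.

(** Makes the scheme available on such graphs through their representatives; the absence of odd
    cycles pulls back along the strict homomorphism from the representative to [G]. *)
Lemma rep_no_odd_cycle (rs : repsys) (U' : ugraph -> Prop) (R G : ugraph) :
  setting rs U' R -> no_odd_cycle G -> U' (rep rs G).
Proof.
have inU : in_U rs (rep rs G) by rewrite /in_U -(rep_eq rs (rep_iso rs G)).
case=> [[_ h] _|[_ h _] hG]; first exact/h.
apply: h; split=> //.
pose f := @mk_shom G G id (fun _ _ e => conj e id).
exact: shom_no_odd_cycle (iso_transport (rep_iso rs G) f) hG.
Qed.

(** * Invariance under isomorphism *)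

Lemma nbr_iso (G H : ugraph) (i : giso G H) (v : G) : nbr (i v) = i @: nbr v.
Proof.
have inj_i := can_inj (iso_funK i).
apply/setP => w; rewrite -(iso_invK i w) mem_imset //.
by rewrite !inE iso_edge (inj_eq inj_i).
Qed.

Lemma iso_transportE (G H T : ugraph) (i : giso G H) (f : shom G T) (v : G) :
  iso_transport i f (i v) = f v.
Proof. by rewrite mk_shomE iso_funK. Qed.

Lemma alpha_iso_transport (G H T : ugraph) (i : giso G H) (f : shom G T)
    (v : G) :
  alpha (iso_transport i f) (i v) = alpha f v.
Proof.
apply: val_inj; rewrite /= iso_transportE nbr_iso -imset_comp; congr (_, _).
by apply: eq_imset => w /=; rewrite iso_transportE.
Qed.

Lemma shom_ext (G H : ugraph) (f g : shom G H) : f =1 g -> f = g.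
Proof. by move=> fg; apply/val_inj/ffunP. Qed.

(** * Stars and their homomorphisms *)

(** [None] is the center and [L] indexes the leaves. An empty [L] is allowed and serves the vertices
    of E(R) with empty second component. *)
Definition star_edges (L : finType) : {set {set option L}} :=
  [set [set None; Some l] | l : L].

Lemma star_edgesP (L : finType) (x y : option L) :
  [set x; y] \in star_edges L ->
  (x = None /\ exists l, y = Some l) \/ (y = None /\ exists l, x = Some l).
Proof.
case/imsetP=> l _ xy.
have : x \in [set None; Some l] by rewrite -xy set21.
have : y \in [set None; Some l] by rewrite -xy set22.
have : Some l \in [set x; y] by rewrite xy set22.
have : None \in [set x; y] by rewrite xy set21.
rewrite !inE; case: x {xy} => [k|]; case: y => [m|] //= _ _ _ _.
  by right; split=> //; exists k.
by left; split=> //; exists m.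
Qed.

Lemma star_gt0 (L : finType) : 0 < #|{: option L}|.
Proof. by apply/card_gt0P; exists None. Qed.

Lemma star_edges_card (L : finType) e : e \in star_edges L -> 0 < #|e| <= 2.
Proof. by case/imsetP=> l _ ->; rewrite cards2. Qed.

Definition star (L : finType) : ugraph :=
  UGraph (star_gt0 L) (@star_edges_card L).

Lemma star_edge (L : finType) (l : L) : [edge None; Some l of star L].
Proof. exact: imset_f. Qed.

Lemma star_no_odd_cycle (L : finType) : no_odd_cycle (star L).
Proof.
apply: (@bicoloring_no_odd_cycle (star L) (fun x : option L => x : bool)).
by move=> v w /andP[_ /star_edgesP[] [-> [l ->]]].
Qed.

Lemma nbr_center (L : finType) :
  @nbr (star L) None = [set Some l | l : L].
Proof.
apply/setP => -[l|]; rewrite inE /=.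
  by rewrite star_edge imset_f.
by apply/esym/imsetP => -[].
Qed.

Lemma nbr_leaf (L : finType) (l : L) : @nbr (star L) (Some l) = [set None].
Proof.
apply/setP => -[k|]; rewrite !inE; last by rewrite setUC star_edge.
by apply/negP => /andP[_ /star_edgesP[] []].
Qed.

Definition star_fun (L : finType) (R : ugraph) (v : R) (f : L -> R)
    (x : star L) : R := oapp f v x.

Lemma star_fun_subproof (L : finType) (R : ugraph) (v : R) (f : L -> R) :
  (forall l, f l \in nbr v) -> forall x y, [edge x; y of star L] ->
  [edge star_fun v f x; star_fun v f y of R] /\
  (x != y -> star_fun v f x != star_fun v f y).
Proof.
move=> hf x y /star_edgesP[] [-> [l ->]];
  have := hf l; rewrite inE => /andP[fv e]; split=> //=.
- by rewrite eq_sym.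
- by rewrite setUC.
Qed.

(** Distinct leaves may share an image, as can happen when [L] is a correspondence. *)
Definition star_hom (L : finType) (R : ugraph) (v : R) (f : L -> R)
    (hf : forall l, f l \in nbr v) : shom (star L) R :=
  mk_shom (star_fun_subproof hf).

Lemma alpha_center (L : finType) (R : ugraph) (v : R) (f : L -> R)
    (hf : forall l, f l \in nbr v) :
  val (alpha (star_hom hf) None) = (v, [set f l | l : L]).
Proof.
rewrite /= mk_shomE nbr_center -imset_comp; congr (_, _).
by apply: eq_imset => l /=; rewrite mk_shomE.
Qed.

Lemma alpha_leaf (L : finType) (R : ugraph) (v : R) (f : L -> R)
    (hf : forall l, f l \in nbr v) (l : L) :
  val (alpha (star_hom hf) (Some l)) = (f l, [set v]).
Proof. by rewrite /= nbr_leaf imset_set1 !mk_shomE. Qed.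

(** * Vertices of E(R) as star centers *)

Lemma realizer_subproof (R : ugraph) (a : evertex R)
    (d : {d : R | d \in (val a).2}) :
  val d \in nbr (val a).1.
Proof. exact: subsetP (valP a) _ (valP d). Qed.

Definition realizer (R : ugraph) (a : evertex R) :
    shom (star {d : R | d \in (val a).2}) R :=
  star_hom (@realizer_subproof R a).

Lemma alpha_realizer (R : ugraph) (a : evertex R) : alpha (realizer a) None = a.
Proof.
apply: val_inj; rewrite alpha_center [RHS]surjective_pairing; congr (_, _).
apply/setP => d; apply/imsetP/idP => [[x _ ->]|da]; first exact: valP.
by exists (Sub d da).
Qed.

Lemma ev_edge_alpha (rs : repsys) (U' : ugraph -> Prop) (R G : ugraph)
    (hU : setting rs U' R) (hG : no_odd_cycle G) (T : ugraph) (xi : shom G T)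
    (v w : G) :
  [edge v; w of G] -> [edge (alpha xi v : EV U' T); alpha xi w of EV U' T].
Proof.
move=> e; apply/ev_edgeP; pose i := rep_iso rs G.
exists (exist _ _ (rep_no_odd_cycle hU hG)), (iso_transport i xi), (i v), (i w).
by split; rewrite ?alpha_iso_transport ?iso_edge.
Qed.

(** An edge at [a] comes from some [xi] with [a = alpha xi v], so the first component of the other
    end lies in [xi @: nbr v], which is [a.2]. Conversely, each element of [a.2] is reached by a
    leaf of [realizer a]. *)
Lemma alpha_phi (rs : repsys) (U' : ugraph -> Prop) (R : ugraph)
    (hU : setting rs U' R) (a : EV U' R) :
  alpha (phi U' R) a = a.
Proof.
apply: val_inj; rewrite /= mk_shomE [RHS]surjective_pairing; congr (_, _).
apply/setP => d; apply/imsetP/idP => [[b]|da].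
  rewrite inE mk_shomE => /andP[ba /ev_edgeP[G [xi [v [w [e aE bE]]]]]] ->.
  rewrite aE bE /= imset_f // inE e andbT.
  by apply: contra_neq ba => wv; rewrite aE bE wv.
pose l : {d : R | d \in (val a).2} := Sub d da.
(* This is the vertex [(d, {a.1})], adjacent to [a] because [a] comes from the center. *)
exists (alpha (realizer a) (Some l)); last by rewrite mk_shomE alpha_leaf.
have e := ev_edge_alpha hU (@star_no_odd_cycle _) (realizer a) (star_edge l).
rewrite alpha_realizer in e; rewrite inE e andbT.
have := shom_proper (realizer a) (star_edge l) isT.
apply: contra_neq => la; have := etrans la (esym (alpha_realizer a)).
by move=> /(congr1 (fun c : evertex R => (val c).1)) /= ->.
Qed.

(** * Properties of epsilon *)

Section Epsilon.

Variables (rs : repsys) (U' : ugraph -> Prop) (R S : ugraph).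
Variables (hU : setting rs U' R) (rho : scheme U' R S).
Arguments rho : clear implicits.
Hypothesis rho_strong : strong rho.
Hypothesis rho_alpha : forall (G H : member U') (xi : shom G R)
    (zeta : shom H R) (v : G) (w : H),
  alpha xi v = alpha zeta w -> alpha (rho G xi) v = alpha (rho H zeta) w.

Local Notation eps := (epsilon hU rho).

(** The map [alpha phi] fixes [alpha xi v], so [rho_alpha] applies to [xi] at [v] and [phi] at
    [alpha xi v]. *)
Lemma epsilon_alpha (G : member U') (xi : shom G R) (v : G) :
  alpha (rho G xi) v = eps (alpha xi v).
Proof. by apply: rho_alpha; rewrite alpha_iso_transport (alpha_phi hU). Qed.

Lemma epsilon_snd (G : ugraph) (hG : no_odd_cycle G) (xi : shom G R) (v : G) :
  (val (eps (alpha xi v))).2 =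
  [set (val (eps (alpha xi w))).1 | w in nbr v].
Proof.
pose i := rep_iso rs G; pose M : member U' := exist _ _ (rep_no_odd_cycle hU hG).
have E w : alpha (rho M (iso_transport i xi)) (i w) = eps (alpha xi w).
  by rewrite epsilon_alpha alpha_iso_transport.
rewrite -E [LHS]/= nbr_iso -imset_comp.
by apply: eq_imset => w; rewrite -E.
Qed.

(** The first components are the values of [rho] on the transported homomorphisms, and [rho] is
    injective. *)
Lemma epsilon_separates (G : ugraph) (hG : no_odd_cycle G) (xi zeta : shom G R) :
  (forall v, (val (eps (alpha xi v))).1 = (val (eps (alpha zeta v))).1) ->
  xi =1 zeta.
Proof.
move=> h v.
pose i := rep_iso rs G; pose M : member U' := exist _ _ (rep_no_odd_cycle hU hG).
rewrite -(iso_transportE i xi) -(iso_transportE i zeta).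
congr (shom_fun _ _); apply: (@rho_strong M); apply: shom_ext => x.
have E z w : alpha (rho M (iso_transport i z)) (i w) = eps (alpha z w).
  by rewrite epsilon_alpha alpha_iso_transport.
by have := h (iso_inv i x); rewrite -!E /= iso_invK.
Qed.

Lemma epsilon_inj : injective eps.
Proof.
move=> a b eab.
pose leaf (c : evertex R) l := (val (eps (alpha (realizer c) (Some l)))).1.
have leafE c : (val (eps c)).2 = [set leaf c l | l : {d : R | d \in (val c).2}].
  rewrite -{1}(alpha_realizer c) (epsilon_snd (@star_no_odd_cycle _)).
  by rewrite nbr_center -imset_comp.
(* The correspondence between the leaves at [a] and at [b]; its pairs index the leaves of the common
   star. *)
pose L : finType := {p : {d : R | d \in (val a).2} * {e : R | e \in (val b).2} |
  leaf a p.1 == leaf b p.2}.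
have hf (p : L) : val (val p).1 \in nbr (val a).1 by exact: realizer_subproof.
have hg (p : L) : val (val p).2 \in nbr (val b).1 by exact: realizer_subproof.
have fE : alpha (star_hom hf) None = a.
  apply: val_inj; rewrite alpha_center [RHS]surjective_pairing; congr (_, _).
  apply/setP => d; apply/imsetP/idP => [[p _ ->]|da]; first exact: valP.
  (* Totality: the value at any leaf over [a] lies in the second component of [eps a = eps b], so
     some leaf over [b] matches it. *)
  have : leaf a (Sub d da) \in (val (eps b)).2 by rewrite -eab leafE imset_f.
  rewrite leafE => /imsetP[e _ /eqP de].
  by exists (Sub (Sub d da, e) de).
have gE : alpha (star_hom hg) None = b.
  apply: val_inj; rewrite alpha_center [RHS]surjective_pairing; congr (_, _).
  apply/setP => e; apply/imsetP/idP => [[p _ ->]|eb]; first exact: valP.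
  have : leaf b (Sub e eb) \in (val (eps a)).2 by rewrite eab leafE imset_f.
  rewrite leafE => /imsetP[d _ /esym/eqP de].
  by exists (Sub (d, Sub e eb) de).
apply: etrans (esym fE) (etrans _ gE).
suff -> : star_hom hf = star_hom hg by [].
apply/shom_ext/(epsilon_separates (@star_no_odd_cycle _)) => -[p|]; last first.
  by rewrite fE gE eab.
(* At a leaf, [alpha] depends only on the images of the leaf and of the center, so the common star
   may be replaced by the realizer. *)
have -> : alpha (star_hom hf) (Some p) = alpha (realizer a) (Some (val p).1).
  by apply: val_inj; rewrite !alpha_leaf.
have -> : alpha (star_hom hg) (Some p) = alpha (realizer b) (Some (val p).2).
  by apply: val_inj; rewrite !alpha_leaf.
exact/eqP/(valP p).
Qed.

End Epsilon.

Theorem theorem8 (rs : repsys) (R S : ugraph) (U' : ugraph -> Prop)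
    (hU : setting rs U' R) (rho : scheme U' R S) (rho_strong : strong rho)
    (rho_alpha : forall (G H : member U') (xi : shom G R) (zeta : shom H R)
       (v : G) (w : H),
       alpha xi v = alpha zeta w ->
       alpha (rho G xi) v = alpha (rho H zeta) w) :
  let eps : EV U' R -> EV U' S := epsilon hU rho in
  [/\ injective eps,
      forall (G : member U') (xi : shom G R) (v : G),
        rho G xi v = phi U' S (eps (alpha xi v)) &
      forall (G : member U') (xi : shom G R) (v : G),
        alpha (rho G xi) v = eps (alpha xi v)].
Proof.
move=> eps; split; first exact: epsilon_inj.
- by move=> G xi v; rewrite mk_shomE /eps -epsilon_alpha.
- exact: epsilon_alpha.
Qed.
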